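(* In the setting given in the context, let $\tilde{\boldsymbol\theta}_i^{(0),hp}\in X^{hp}\cap X^\varepsilon$ and $\boldsymbol\theta_i^{(1),hp}\in X^{hp}\cap X^\varepsilon$ be weak $hp$ finite element approximations of $\tilde{\boldsymbol\theta}_i^{(0),\varepsilon}\in X^\varepsilon$ and $\boldsymbol\theta_i^{(1),\varepsilon}\in X^\varepsilon$, which in turn approximate $\tilde{\boldsymbol\theta}_i^{(0)}\in X$ and $\boldsymbol\theta_i^{(1)}\in X$, respectively, $i=1,2,3$. Assume that, with $C_0$ independent of $\varepsilon$ and $\nu$, $$\|\tilde{\boldsymbol\theta}_i^{(0),\varepsilon}-\tilde{\boldsymbol\theta}_i^{(0)}\|_{H(\mathrm{curl},\Omega)}\le C_0\varepsilon,\qquad\|\boldsymbol\theta_i^{(1),\varepsilon}-\boldsymbol\theta_i^{(1)}\|_{H(\mathrm{curl},\Omega)}\le C_0\varepsilon\nu,$$ and that $h,p$ are chosen such that $$\|\tilde{\boldsymbol\theta}_i^{(0),\varepsilon}-\tilde{\boldsymbol\theta}_i^{(0),hp}\|_{H(\mathrm{curl},\Omega)}\le k\exp(-aN_{dof}^{\vartheta}),\qquad\|\boldsymbol\theta_i^{(1),\varepsilon}-\boldsymbol\theta_i^{(1),hp}\|_{H(\mathrm{curl},\Omega)}\le k\exp(-aN_{dof}^{\vartheta}),$$ where $N_{dof}$ is the number of degrees of freedom, $\vartheta>0$, and $k,a>0$ depend on the problem parameters but not on $N_{dof}$. Then for all $i,j\in\{1,2,3\}$ $$\begin{aligned}\left|(\mathcal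 N^{(0)})_{ij}-(\mathcal N^{(0),hp})_{ij}\right|\le{}& C_1\varepsilon\alpha^3\left(\varepsilon+\|\nabla\times\tilde{\boldsymbol\theta}_i^{(0),\varepsilon}\|_{L^2(\Omega)}+\|\nabla\times\tilde{\boldsymbol\theta}_j^{(0),\varepsilon}\|_{L^2(\Omega)}\right)\\&+C_2\exp(-aN_{dof}^\vartheta)\left(\exp(-aN_{dof}^\vartheta)+\|\nabla\times\tilde{\boldsymbol\theta}_i^{(0),hp}\|_{L^2(\Omega)}+\|\nabla\times\tilde{\boldsymbol\theta}_j^{(0),hp}\|_{L^2(\Omega)}\right),\end{aligned}$$ where $C_2$ and $a$ depend on $\varepsilon$ and $\alpha$, and $$\begin{aligned}\left|(\mathcal R)_{ij}-(\mathcal R^{hp})_{ij}\right|\le{}& C_1\varepsilon\nu\alpha^3\left(\varepsilon\nu+\|\nabla\times\boldsymbol\theta_i^{(1),\varepsilon}\|_{L^2(\Omega)}+\|\nabla\times\boldsymbol\theta_j^{(1),\varepsilon}\|_{L^2(\Omega)}\right)\\&+C_2\exp(-aN_{dof}^\vartheta)\left(\exp(-aN_{dof}^\vartheta)+\|\nabla\times\boldsymbol\theta_i^{(1),hp}\|_{L^2(\Omega)}+\|\nabla\times\boldsymbol\theta_j^{(1),hp}\|_{L^2(\Omega)}\right),\end{aligned}$$ $$\begin{aligned}\left|(\mathcal I)_{ij}-(\mathcal I^{hp})_{ij}\right|\le{}& C_1\varepsilon\nu^2\alpha^3\left(1+\varepsilon\nu+\|\boldsymbol\theta_i^{(1),\varepsilon}\|_{L^2(B)}+\|\boldsymbol\theta_j^{(1),\varepsilon}\|_{L^2(B)}\right)\\&+C_2\exp(-aN_{dof}^\vartheta)\left(1+\exp(-aN_{dof}^\vartheta)+\|\boldsymbol\theta_i^{(1),hp}\|_{L^2(B)}+\|\boldsymbol\theta_j^{(1),hp}\|_{L^2(B)}\right),\end{aligned}$$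 with $C_2$ and $a$ additionally depending on $\nu$. Here $C_1>0$ is independent of $\varepsilon,\nu,\alpha$, and $C_1,C_2,a$ are independent of $N_{dof}$.
   Context: $B\subset\Omega\subset\mathbb{R}^3$ are bounded Lipschitz polyhedra with $\overline B\subset\Omega$, $\Omega$ having convex boundary; $\alpha>0$ (object size), $\nu>0$, regularisation parameter $\varepsilon>0$ (small), $\mu_r>0$ constant, $\tilde\mu_r=\mu_r$ in $B$ and $\tilde\mu_r=1$ in $\Omega\setminus\overline B$; $e_1,e_2,e_3$ is the standard basis, $\boldsymbol\xi$ the position vector, $\mathrm{i}$ the imaginary unit, $\delta_{ij}$ the Kronecker delta. $\|u\|_{H(\mathrm{curl},\Omega)}^2=\|u\|_{L^2(\Omega)}^2+\|\nabla\times u\|_{L^2(\Omega)}^2$. $X^\varepsilon=\{u\in H(\mathrm{curl},\Omega): n\times u=0\text{ on }\partial\Omega\}$ and $X=\{u\in X^\varepsilon:\nabla\cdot u=0\text{ in }\Omega\setminus\overline B\}$; $X^{hp}\subset H(\mathrm{curl},\Omega)$ is a finite-dimensional space spanned by $H(\mathrm{curl})$-conforming finite element basis functions on a mesh of size $h$ with element order $p$. Fields: $\tilde{\boldsymbol\theta}_i^{(0)}\in X$ (real) satisfies $\int_\Omega\tilde\mu_r^{-1}\nabla\times\tilde{\boldsymbol\theta}_i^{(0)}\cdot\nabla\times w\,d\xi=2\int_B(1-\mu_r^{-1})e_i\cdot\nabla\times w\,d\xi$ for all $w\in X$; $\tilde{\boldsymbol\theta}_i^{(0),\varepsilon}\in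 X^\varepsilon$ (real) satisfies the same equation with the extra term $\varepsilon\int_\Omega\tilde{\boldsymbol\theta}_i^{(0),\varepsilon}\cdot w\,d\xi$ on the left, for all $w\in X^\varepsilon$. Put $\boldsymbol\theta_i^{(0)}=\tilde{\boldsymbol\theta}_i^{(0)}+e_i\times\boldsymbol\xi$; this field is regarded as a known source independent of $\nu$, and the same $\boldsymbol\theta_i^{(0)}$ is used in all problems below. The complex field $\boldsymbol\theta_i^{(1)}\in X$ satisfies $\int_\Omega\tilde\mu_r^{-1}\nabla\times\boldsymbol\theta_i^{(1)}\cdot\nabla\times\overline w\,d\xi-\mathrm{i}\int_B\nu\boldsymbol\theta_i^{(1)}\cdot\overline w\,d\xi=\mathrm{i}\int_B\nu\boldsymbol\theta_i^{(0)}\cdot\overline w\,d\xi$ for all $w\in X$; $\boldsymbol\theta_i^{(1),\varepsilon}\in X^\varepsilon$ satisfies the same equation with the extra term $\varepsilon\int_{\Omega\setminus\overline B}\boldsymbol\theta_i^{(1),\varepsilon}\cdot\overline w\,d\xi$ on the left, for all $w\in X^\varepsilon$. The fields $\tilde{\boldsymbol\theta}_i^{(0),hp},\boldsymbol\theta_i^{(1),hp}\in X^{hp}\cap X^\varepsilon$ satisfy the two regularised equations with test functions restricted to $X^{hp}\cap X^\varepsilon$. Tensor coefficients on $\Omega$: $(\mathcal N^{(0)})_{ij}=\alpha^3\delta_{ij}\int_B(1-\tilde\mu_r^{-1})d\xi+\frac{\alpha^3}{4}\int_\Omega\tilde\mu_r^{-1}\nabla\times\tilde{\boldsymbol\theta}_i^{(0)}\cdot\nabla\times\tilde{\boldsymbol\theta}_j^{(0)}d\xi$,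 $(\mathcal R)_{ij}=-\frac{\alpha^3}{4}\int_\Omega\tilde\mu_r^{-1}\nabla\times\boldsymbol\theta_i^{(1)}\cdot\nabla\times\overline{\boldsymbol\theta_j^{(1)}}d\xi$, $(\mathcal I)_{ij}=\frac{\alpha^3}{4}\int_B\nu(\boldsymbol\theta_i^{(1)}+\boldsymbol\theta_i^{(0)})\cdot\overline{(\boldsymbol\theta_j^{(1)}+\boldsymbol\theta_j^{(0)})}d\xi$. The discrete coefficients $(\mathcal N^{(0),hp})_{ij},(\mathcal R^{hp})_{ij},(\mathcal I^{hp})_{ij}$ are given by the same formulas with $\tilde{\boldsymbol\theta}_i^{(0)}$ and $\boldsymbol\theta_i^{(1)}$ replaced by $\tilde{\boldsymbol\theta}_i^{(0),hp}$ and $\boldsymbol\theta_i^{(1),hp}$ ($\boldsymbol\theta_i^{(0)}$ unchanged). *)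

(* Defs.v *)
From HB Require Import structures.
From mathcomp Require Import all_boot all_order all_algebra complex.
From mathcomp Require Import all_classical all_reals all_analysis.

Set Implicit Arguments.
Unset Strict Implicit.
Unset Printing Implicit Defensive.

Import Order.TTheory GRing.Theory Num.Theory numFieldNormedType.Exports.

Local Open Scope classical_set_scope.
Local Open Scope ring_scope.

(* Points of R^3 are triples, so that they carry both the product
   sigma-algebra and the product topology; the values of vector fields are
   row vectors.  Indices live in 'I_3, whose addition is modulo 3. *)
Notation pt R := (R * R * R)%type.
Notation vfield R K := (R * R * R -> 'rV[K]_3).

(* An element of H(curl) is represented by its graph: the pair
   (u, curl u).  The weak curl is unique up to a null set, and the vector
   space operations on pairs are those of H(curl). *)
Notation hfield R := (vfield R R * vfield R R)%type.
Notation hfieldC R := (vfield R R[i] * vfield R R[i])%type.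

Definition leb3 (R : realType) :=
  ((@lebesgue_measure R \x @lebesgue_measure R) \x @lebesgue_measure R)%E.
Arguments leb3 R : clear implicits.

Definition xi (R : realType) (x : pt R) : 'rV[R]_3 :=
  \row_k nth 0 [:: x.1.1; x.1.2; x.2] k.

Definition ept (R : realType) (k : 'I_3) : pt R :=
  ((k == 0)%:R, (k == 1)%:R, (k == 2%:R)%:R).
Arguments ept R k : clear implicits.
Definition evec (R : realType) (k : 'I_3) : 'rV[R]_3 := delta_mx 0 k.
Arguments evec R k : clear implicits.

(* Bilinear, also over R[i]: the conjugations are written out where used. *)
Definition dotp (K : pzRingType) (u v : 'rV[K]_3) : K :=
  \sum_k u 0 k * v 0 k.

Definition cross (K : pzRingType) (u v : 'rV[K]_3) : 'rV[K]_3 :=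
  \row_k (u 0 (k + 1) * v 0 (k + 1 + 1) - u 0 (k + 1 + 1) * v 0 (k + 1)).

Definition partial (R : realType) (k : 'I_3) (f : pt R -> R) : pt R -> R :=
  fun x => 'D_(ept R k) f x.

(* C^infinity: differentiability of all iterated partial derivatives also
   gives their continuity. *)
Definition smooth (R : realType) (f : pt R -> R) : Prop :=
  forall (s : seq 'I_3) (x : pt R),
    differentiable (foldr (@partial R) f s) x.

Definition smoothV (R : realType) (phi : vfield R R) : Prop :=
  forall k : 'I_3, smooth (fun x => phi x 0 k).

Definition compactly_supported (R : realType) (V : zmodType)
    (D : set (pt R)) (f : pt R -> V) : Prop :=
  exists K : set (pt R),
    [/\ compact K, K `<=` D & forall x, ~ K x -> f x = 0].

Definition gradient (R : realType) (f : pt R -> R) : vfield R R :=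
  fun x => \row_k partial k f x.

Definition curl (R : realType) (phi : vfield R R) : vfield R R :=
  fun x => \row_k
    (partial (k + 1) (fun y => phi y 0 (k + 1 + 1)) x
     - partial (k + 1 + 1) (fun y => phi y 0 (k + 1)) x).

(* Measurability is Borel measurability; every class in L^2 has a Borel
   representative. *)
Definition L2 (R : realType) (D : set (pt R)) (u : vfield R R) : Prop :=
  forall k : 'I_3, measurable_fun D (fun x => u x 0 k) /\
    (leb3 R).-integrable D (fun x => ((u x 0 k) ^+ 2)%:E).

Definition L2norm (R : realType) (D : set (pt R)) (u : vfield R R) : R :=
  Num.sqrt (\int[leb3 R]_(x in D) dotp (u x) (u x)).

Definition weak_curl (R : realType) (Omega : set (pt R)) (u v : vfield R R) :
    Prop :=
  forall phi : vfield R R, smoothV phi -> compactly_supported Omega phi ->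
    \int[leb3 R]_(x in Omega) dotp (u x) (curl phi x) =
    \int[leb3 R]_(x in Omega) dotp (v x) (phi x).

Definition Hcurl (R : realType) (Omega : set (pt R)) : set (hfield R) :=
  [set u | [/\ L2 Omega u.1, L2 Omega u.2 & weak_curl Omega u.1 u.2]].

Definition Hcurl_norm (R : realType) (Omega : set (pt R)) (u : hfield R) : R :=
  Num.sqrt (L2norm Omega u.1 ^+ 2 + L2norm Omega u.2 ^+ 2).

(* n x u = 0 on the boundary: the tangential trace of u in H(curl) is the
   functional  phi |-> \int (curl u . phi - u . curl phi)  given by Green's
   formula, on the (traces of) fields smooth up to the boundary. *)
Definition zero_tangential_trace (R : realType) (Omega : set (pt R))
    (u : hfield R) : Prop :=
  forall phi : vfield R R, smoothV phi ->
    \int[leb3 R]_(x in Omega) dotp (u.2 x) (phi x) =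
    \int[leb3 R]_(x in Omega) dotp (u.1 x) (curl phi x).

Definition weakly_div_free (R : realType) (D : set (pt R)) (u : vfield R R) :
    Prop :=
  forall phi : pt R -> R, smooth phi -> compactly_supported D phi ->
    \int[leb3 R]_(x in D) dotp (u x) (gradient phi x) = 0.

Definition Xeps (R : realType) (Omega : set (pt R)) : set (hfield R) :=
  [set u | Hcurl Omega u /\ zero_tangential_trace Omega u].

Definition X (R : realType) (Omega B : set (pt R)) : set (hfield R) :=
  [set u | Xeps Omega u /\ weakly_div_free (Omega `\` closure B) u.1].

Definition re_field (R : realType) (u : vfield R R[i]) : vfield R R :=
  fun x => map_mx (@complex.Re R) (u x).
Definition im_field (R : realType) (u : vfield R R[i]) : vfield R R :=
  fun x => map_mx (@complex.Im R) (u x).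
Definition to_complex (R : realType) (u : vfield R R) : vfield R R[i] :=
  fun x => map_mx (real_complex R) (u x).
Definition conj_vec (R : realType) (v : 'rV[R[i]]_3) : 'rV[R[i]]_3 :=
  map_mx (@conjc R) v.

(* S + i S; X, X^eps and X^hp are defined by real linear conditions, so this
   gives their complex-valued versions. *)
Definition complexify (R : realType) (S : set (hfield R)) : set (hfieldC R) :=
  [set u | S (re_field u.1, re_field u.2) /\ S (im_field u.1, im_field u.2)].

Definition cintegral (R : realType) (D : set (pt R)) (f : pt R -> R[i]) :
    R[i] :=
  ((\int[leb3 R]_(x in D) complex.Re (f x))
   +i* (\int[leb3 R]_(x in D) complex.Im (f x)))%C.

Definition L2normC (R : realType) (D : set (pt R)) (u : vfield R R[i]) : R :=
  Num.sqrt (L2norm D (re_field u) ^+ 2 + L2norm D (im_field u) ^+ 2).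

Definition Hcurl_normC (R : realType) (Omega : set (pt R)) (u : hfieldC R) :
    R :=
  Num.sqrt (L2normC Omega u.1 ^+ 2 + L2normC Omega u.2 ^+ 2).

(* The graph condition is required on a neighbourhood of x in the coordinates
   of an orthonormal frame Q centred at x; the usual cylinder is contained in
   such a neighbourhood. *)
Definition lipschitz_boundary (R : realType) (D : set (pt R)) : Prop :=
  forall x, (closure D `\` D°) x ->
    exists (Q : 'M[R]_3) (g : R * R -> R),
      [/\ Q *m Q^T = 1%:M, lipschitz g &
          \forall y \near x,
            let z := (xi y - xi x) *m Q in
            D y <-> g (z 0 0, z 0 1) < z 0 (1 + 1)].

(* A finite union of convex polyhedra.  A common number n of half-spaces is no
   restriction: a i j = 0, b i j = 0 imposes nothing. *)
Definition polyhedral (R : realType) (D : set (pt R)) : Prop :=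
  exists (m n : nat) (a : 'I_m -> 'I_n -> 'rV[R]_3) (b : 'I_m -> 'I_n -> R),
    closure D = [set x | exists i, forall j, dotp (a i j) (xi x) <= b i j].

Definition bounded_lipschitz_polyhedron (R : realType) (D : set (pt R)) :
    Prop :=
  [/\ open D, D !=set0, bounded_set D, lipschitz_boundary D & polyhedral D].

Definition edist (R : realType) (x y : pt R) : R :=
  Num.sqrt (dotp (xi x - xi y) (xi x - xi y)).

Definition convex_hull (R : realType) (s : seq (pt R)) : set (pt R) :=
  [set x | exists t : 'I_(size s) -> R,
     [/\ forall i, 0 <= t i, \sum_i t i = 1 &
         x = \sum_i t i *: (nth 0 s i : pt R)]].

(* A mesh is the list of the vertex lists of its elements: nondegenerate convex
   polytopes without overlap that fill the domain, h being the largest element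
   diameter. *)
Definition is_mesh (R : realType) (Omega : set (pt R)) (h : R)
    (T : seq (seq (pt R))) : Prop :=
  [/\ forall s, s \in T -> (convex_hull s)° !=set0,
      closure Omega = \bigcup_(s in [set` T]) convex_hull s,
      forall j k, (j < size T)%N -> (k < size T)%N -> j != k ->
        (convex_hull (nth [::] T j))° `&` (convex_hull (nth [::] T k))° = set0,
      forall s x y, s \in T -> convex_hull s x -> convex_hull s y ->
        edist x y <= h &
      exists s x y, [/\ s \in T, convex_hull s x, convex_hull s y &
        edist x y = h]].

Definition polynomial_on (R : realType) (D : set (pt R)) (d : nat)
    (f : pt R -> R) : Prop :=
  exists c : nat -> nat -> nat -> R, forall x, D x ->
    f x = \sum_(i < d.+1) \sum_(j < d.+1) \sum_(k < d.+1 | (i + j + k <= d)%N)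
            c i j k * x.1.1 ^+ i * x.1.2 ^+ j * x.2 ^+ k.

Definition ae_eq_hfield (R : realType) (D : set (pt R)) (u v : hfield R) :
    Prop :=
  {ae leb3 R, forall x, D x -> u.1 x = v.1 x /\ u.2 x = v.2 x}.

(* Nedelec shape functions of order p >= 0 have components of total degree at
   most p + 1 on tetrahedra. *)
Definition is_hp_basis (R : realType) (Omega : set (pt R)) (h : R) (p N : nat)
    (phi : 'I_N -> hfield R) : Prop :=
  [/\ exists2 T, is_mesh Omega h T &
        forall n s k, s \in T ->
          polynomial_on (convex_hull s)° p.+1 (fun x => (phi n).1 x 0 k),
      forall n, Hcurl Omega (phi n) &
      forall c : 'I_N -> R,
        ae_eq_hfield Omega (\sum_n c n *: phi n) 0 -> forall n, c n = 0].

Definition Xhp (R : realType) (Omega : set (pt R)) (N : nat)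
    (phi : 'I_N -> hfield R) : set (hfield R) :=
  [set u | exists c : 'I_N -> R, ae_eq_hfield Omega u (\sum_n c n *: phi n)].

Definition mu_tilde (R : realType) (B : set (pt R)) (mur : R) (x : pt R) : R :=
  if x \in B then mur else 1.

(* V is both trial and test space; the unregularised problem is the case
   eps = 0 and the discrete one has V inside X^hp. *)
Definition solves_theta0 (R : realType) (Omega B : set (pt R)) (mur eps : R)
    (V : set (hfield R)) (i : 'I_3) (tt : hfield R) : Prop :=
  V tt /\ forall w, V w ->
    \int[leb3 R]_(x in Omega) ((mu_tilde B mur x)^-1 * dotp (tt.2 x) (w.2 x))
    + eps * \int[leb3 R]_(x in Omega) dotp (tt.1 x) (w.1 x)
    = 2 * \int[leb3 R]_(x in B) ((1 - mur^-1) * dotp (evec R i) (w.2 x)).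

Definition theta0 (R : realType) (tt : 'I_3 -> hfield R) (i : 'I_3) :
    vfield R R :=
  fun x => (tt i).1 x + cross (evec R i) (xi x).

Definition solves_theta1 (R : realType) (Omega B : set (pt R))
    (mur nu eps : R) (V : set (hfieldC R)) (th0 : vfield R R)
    (th : hfieldC R) : Prop :=
  V th /\ forall w, V w ->
    cintegral Omega (fun x => ((mu_tilde B mur x)^-1)%:C%C
                              * dotp (th.2 x) (conj_vec (w.2 x)))
    - 'i%C * cintegral B (fun x => nu%:C%C * dotp (th.1 x) (conj_vec (w.1 x)))
    + eps%:C%C * cintegral (Omega `\` closure B)
                   (fun x => dotp (th.1 x) (conj_vec (w.1 x)))
    = 'i%C * cintegral B (fun x => nu%:C%C
                            * dotp (to_complex th0 x) (conj_vec (w.1 x))).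

Definition N0 (R : realType) (Omega B : set (pt R)) (mur alpha : R)
    (tt : 'I_3 -> hfield R) (i j : 'I_3) : R :=
  alpha ^+ 3 * (i == j)%:R
    * \int[leb3 R]_(x in B) (1 - (mu_tilde B mur x)^-1)
  + alpha ^+ 3 / 4
    * \int[leb3 R]_(x in Omega)
        ((mu_tilde B mur x)^-1 * dotp ((tt i).2 x) ((tt j).2 x)).

Definition Rcoef (R : realType) (Omega B : set (pt R)) (mur alpha : R)
    (th : 'I_3 -> hfieldC R) (i j : 'I_3) : R[i] :=
  - ((alpha ^+ 3 / 4)%:C%C
     * cintegral Omega (fun x => ((mu_tilde B mur x)^-1)%:C%C
                         * dotp ((th i).2 x) (conj_vec ((th j).2 x)))).

Definition Icoef (R : realType) (B : set (pt R)) (nu alpha : R)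
    (th0 : 'I_3 -> vfield R R) (th : 'I_3 -> hfieldC R) (i j : 'I_3) : R[i] :=
  (alpha ^+ 3 / 4)%:C%C
  * cintegral B (fun x => nu%:C%C
      * dotp ((th i).1 x + to_complex (th0 i) x)
             (conj_vec ((th j).1 x + to_complex (th0 j) x))).

(* Main.v *)
Require Import Defs.
From HB Require Import structures.
From mathcomp Require Import all_boot all_order all_algebra complex.
From mathcomp Require Import all_classical all_reals all_analysis.
From mathcomp Require Import measurable_realfun ring lra.
Import Order.TTheory GRing.Theory Num.Theory numFieldNormedType.Exports.
Local Open Scope classical_set_scope.
Local Open Scope ring_scope.
Set Implicit Arguments.
Unset Strict Implicit.

(** Every coefficient is, up to constant factors, a weighted L^2 pairing
    [\int w u . v] of two fields, and the theorem says that such a pairing is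
    locally Lipschitz in (u, v).  If u and v are moved to u' and v' by at most e
    in norm, then

      <u, v> - <u', v'> = <u' - u, v' - v> - <u' - u, v'> - <u', v' - v>,

    so Cauchy-Schwarz bounds the change by a multiple of
    e (e + |u'| + |v'|); this is [wform_perturb].  It is used twice: from the
    exact field to the regularised one with e = C0 eps (or C0 eps nu), which
    gives the C1 term, and from the regularised field to its discretisation
    with e = k exp(-a N^vt), which gives the C2 term.  The norms on the right
    are those of the second field of each pair, as in the theorem.

    For the complex coefficients, the real and imaginary parts of u . conj v
    are combinations of four real pairings, whence a factor 4
    ([cform_perturb]) that cancels the 4 in alpha^3 / 4.  The coefficient I
    pairs theta1 + theta0 with itself: the added theta0 does not change the
    differences, and it enlarges the norms by at most t, a bound on the L^2(B)
    norm of theta0.  That norm is finite because B is bounded, so that the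
    rotation field e_i x xi is square integrable, and it depends on theta0
    alone, so that it may enter C1.  It is also the reason for the 1 in the
    bound for I.

    Thus, with M = 1 + 1 / mur bounding the weight 1 / mu and K = 1 + |C0|,
    the constant C1 = M K^2 (1 + 2 t) serves for all three coefficients. *)

(** * Measurability and finite measure of bounded open sets *)
Section Measurability.
Context {R : realType}.
Implicit Types (D : set (pt R)) (u v : vfield R R) (w : pt R -> R).
Local Notation mu := (leb3 R).

Lemma ball_measurable3 (c : pt R) (r : R) : measurable (ball c r).
Proof.
have -> : ball c r = (ball c.1.1 r `*` ball c.1.2 r) `*` ball c.2 r :> set (pt R).
  by [].
by apply: measurableX; [apply: measurableX|];
   apply: open_measurable; exact: ball_open.
Qed.

Lemma rat_near (x e : R) : 0 < e -> exists q : rat, ball (ratr q : R) e x.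
Proof.
move=> e0; have [|q] := @rat_in_itvoo R (x - e) (x + e); first by lra.
rewrite in_itv /= => /andP[h1 h2]; exists q.
by rewrite /ball /= ltr_norml; lra.
Qed.

(** The product sigma-algebra contains the open sets because the space is second
    countable: D is the union of the balls with rational centre and radius
    1 / (n + 1) that it contains. *)
Lemma open_measurable3 D : open D -> measurable D.
Proof.
move=> oD.
pose c (i : rat * rat * rat * nat) : pt R :=
  (ratr i.1.1.1, ratr i.1.1.2, ratr i.1.2).
pose F (i : rat * rat * rat * nat) : set (pt R) :=
  if pselect (ball (c i) i.2.+1%:R^-1 `<=` D) then ball (c i) i.2.+1%:R^-1
  else set0.
have -> : D = \bigcup_i F i.
  apply/seteqP; split=> [x Dx|x [i _]]; last first.
    by rewrite /F; case: pselect => // h /h.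
  have [r /= r0 xrD] : nbhs_ball x D by apply/nbhs_ballP; exact: open_nbhs_nbhs.
  (* A ball of radius below r / 2 around a rational point close to x contains x
     and stays in the ball of radius r around x. *)
  have [n nr] : exists n : nat, n.+1%:R^-1 < r / 2.
    have [n _ /(_ n (leqnn n))] := near_infty_natSinv_lt (PosNum (divr_gt0 r0 (ltr0n R 2))).
    by exists n.
  have e0 : 0 < n.+1%:R^-1 :> R by rewrite invr_gt0.
  have [q1 h1] := rat_near x.1.1 e0.
  have [q2 h2] := rat_near x.1.2 e0.
  have [q3 h3] := rat_near x.2 e0.
  have hx : ball (c (q1, q2, q3, n)) n.+1%:R^-1 x by [].
  exists (q1, q2, q3, n) => //; rewrite /F; case: pselect => // -[].
  move=> y hy; apply: xrD; apply: (@le_ball _ _ _ (n.+1%:R^-1 + n.+1%:R^-1)).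
    by rewrite (splitr r) lerD // ltW.
  by apply: ball_triangle hy; apply: ball_sym.
apply: countable_bigcupT_measurable => // i; rewrite /F.
by case: pselect => h; [exact: ball_measurable3 | exact: measurable0].
Qed.

Lemma bounded_finite_leb3 D : measurable D -> bounded_set D -> (mu D < +oo)%E.
Proof.
move=> mD [M [Mreal MD]].
pose N := `|M| + 1.
have DN x : D x -> `|x| <= N.
  apply: (MD N); rewrite /N; have := ler_norm M; lra.
pose I := `[-N, N]%classic : set R.
have mI : measurable I by exact: measurable_itv.
apply: (@le_lt_trans _ _ (mu ((I `*` I) `*` I))).
  apply: le_measure; rewrite ?inE //.
    by apply: measurableX => //; apply: measurableX.
  move=> x /DN; rewrite prod_normE ge_max prod_normE ge_max => /andP[/andP[]].
  by rewrite /I /= !in_itv /= -!ler_norml => -> -> ->.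
have fI : lebesgue_measure I \is a fin_num.
  by rewrite /I lebesgue_measure_itv; case: ifP.
have fII : ((@lebesgue_measure R) \x (@lebesgue_measure R))%E (I `*` I)
    \is a fin_num.
  by rewrite product_measure1E // fin_numM.
rewrite /leb3 product_measure1E //; last exact: measurableX.
by rewrite ltey_eq fin_numM.
Qed.
End Measurability.

(** * Weighted pairings of square integrable fields *)

Section Weighted_L2.
Context {disp : measure_display} {T : measurableType disp} {R : realType}.
Variable mu : {measure set T -> \bar R}.
Implicit Types (D E : set T) (u v : T -> 'rV[R]_3) (w : T -> R).

(** Square integrability over an arbitrary measure space.  The Lebesgue measure
    on the line lives on a type whose measurable structure is only convertible
    to that of [R]; working over an abstract measure keeps the two apart. *)
Definition sqint D u : Prop :=
  forall k : 'I_3, measurable_fun D (fun x => u x 0 k) /\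
    mu.-integrable D (fun x => ((u x 0 k) ^+ 2)%:E).

Definition l2norm D u : R := Num.sqrt (\int[mu]_(x in D) dotp (u x) (u x)).

(** |f g| <= f^2 + g^2. *)
Lemma integrable_mul D (f g : T -> R) : measurable D ->
  measurable_fun D f -> measurable_fun D g ->
  mu.-integrable D (fun x => (f x ^+ 2)%:E) ->
  mu.-integrable D (fun x => (g x ^+ 2)%:E) ->
  mu.-integrable D (fun x => (f x * g x)%:E).
Proof.
move=> mD mf mg if2 ig2.
apply: (le_integrable mD _ _ (integrableD mD if2 ig2)).
  by apply/measurable_EFinP; exact: measurable_funM.
move=> x Dx; rewrite /= lee_fin [leRHS]ger0_norm ?addr_ge0 ?sqr_ge0//.
rewrite ler_norml; have := sqr_ge0 (f x + g x); have := sqr_ge0 (f x - g x).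
have := sqr_ge0 (f x); have := sqr_ge0 (g x); rewrite !expr2; nra.
Qed.

Lemma integrable_weighted D w (M : R) (f : T -> R) : measurable D ->
  measurable_fun D w -> (forall x, D x -> `|w x| <= M) ->
  mu.-integrable D (EFin \o f) -> mu.-integrable D (EFin \o (fun x => w x * f x)).
Proof.
move=> mD mw wM intf.
have M0 x : D x -> 0 <= M by move=> Dx; exact: le_trans (normr_ge0 _) (wM x Dx).
apply: (le_integrable mD _ _ (integrableZl mD M intf)).
  apply/measurable_EFinP; apply: measurable_funM => //.
  exact/measurable_EFinP/(measurable_int mu).
move=> x Dx; rewrite /= lee_fin !normrM (ger0_norm (M0 x Dx)).
by rewrite ler_wpM2r // wM.
Qed.

Lemma integrable_dotp D u v : measurable D -> sqint D u -> sqint D v ->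
  mu.-integrable D (EFin \o (fun x => dotp (u x) (v x))).
Proof.
move=> mD Lu Lv.
have -> : EFin \o (fun x => dotp (u x) (v x)) =
    (fun x => \sum_(k < 3) (u x 0 k * v x 0 k)%:E)%E.
  by apply/funext => x; rewrite /= /dotp sumEFin.
apply: integrable_sum => // k _.
by apply: integrable_mul => //; [have [] := Lu k|have [] := Lv k|have [] := Lu k|have [] := Lv k].
Qed.

Lemma sqintD D u v : measurable D -> sqint D u -> sqint D v -> sqint D (u + v).
Proof.
move=> mD Lu Lv k; have [mu_ iu] := Lu k; have [mv iv] := Lv k; split.
  have -> : (fun x => (u + v) x 0 k) = (fun x => u x 0 k) \+ (fun x => v x 0 k).
    by apply/funext => x; rewrite fctE mxE.
  exact: measurable_funD.
have iuv := integrable_mul mD mu_ mv iu iv.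
have := integrableD mD (integrableD mD iu iv) (integrableZl mD 2 iuv).
apply: eq_integrable => // x _.
rewrite /= fctE mxE -EFinM -!EFinD; congr EFin; ring.
Qed.

Lemma sqintB D u v : measurable D -> sqint D u -> sqint D v -> sqint D (u - v).
Proof.
move=> mD Lu Lv k; have [mu_ iu] := Lu k; have [mv iv] := Lv k; split.
  have -> : (fun x => (u - v) x 0 k) = (fun x => u x 0 k) \- (fun x => v x 0 k).
    by apply/funext => x; rewrite fctE !mxE.
  exact: measurable_funB.
have iuv := integrable_mul mD mu_ mv iu iv.
have := integrableD mD (integrableD mD iu iv) (integrableZl mD (-2) iuv).
apply: eq_integrable => // x _.
rewrite /= fctE !mxE -EFinM -!EFinD; congr EFin; ring.
Qed.

Lemma sqintS D E u : measurable D -> measurable E -> E `<=` D -> sqint D u -> sqint E u.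
Proof.
move=> mD mE ED Lu k; have [mu_ iu] := Lu k; split.
  exact: measurable_funS mu_.
exact: integrableS iu.
Qed.

Lemma dotp_ge0 (a : 'rV[R]_3) : 0 <= dotp a a.
Proof. by apply: sumr_ge0 => k _; rewrite -expr2 sqr_ge0. Qed.

Lemma sqr_l2norm D u :
  l2norm D u ^+ 2 = \int[mu]_(x in D) dotp (u x) (u x).
Proof. by rewrite sqr_sqrtr // Rintegral_ge0 // => x _; exact: dotp_ge0. Qed.

Lemma l2norm_ge0 D u : 0 <= l2norm D u.
Proof. exact: sqrtr_ge0. Qed.

Lemma l2normS D E u : measurable D -> measurable E -> E `<=` D -> sqint D u ->
  l2norm E u <= l2norm D u.
Proof.
move=> mD mE ED Lu; apply: ler_wsqrtr.
have iD := integrable_dotp mD Lu Lu.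
apply: fine_le; [| |apply: ge0_subset_integral => //].
- apply: integrable_fin_num => //; exact: integrableS iD.
- exact: integrable_fin_num.
- exact: measurable_int iD.
- by move=> x _; rewrite lee_fin dotp_ge0.
Qed.

(** Optimising s in the weighted AM-GM bound recovers the product.  The optimal
    s = b / a is replaced by (b + d) / (a + d) with small d > 0, so that the
    cases a = 0 and b = 0 need no separate treatment. *)
Lemma le_mul_of_weighted_sum (x a b : R) : 0 <= a -> 0 <= b ->
  (forall s : R, 0 < s -> 2 * x <= s * a ^+ 2 + s^-1 * b ^+ 2) -> x <= a * b.
Proof.
move=> a0 b0 h; apply/ler_addgt0Pr => e e0.
pose d := e / (a + b + 1).
have d0 : 0 < d by rewrite divr_gt0 // ltr_wpDl // addr_ge0.
have ad : 0 < a + d by lra.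
have bd : 0 < b + d by lra.
have := h ((b + d) / (a + d)) (divr_gt0 bd ad).
rewrite invf_div => hx.
have h1 : (b + d) / (a + d) * a ^+ 2 <= (b + d) * a.
  rewrite -mulrA ler_wpM2l //; first exact: ltW.
  by rewrite mulrC ler_pdivrMr // expr2 ler_wpM2l //; lra.
have h2 : (a + d) / (b + d) * b ^+ 2 <= (a + d) * b.
  rewrite -mulrA ler_wpM2l //; first exact: ltW.
  by rewrite mulrC ler_pdivrMr // expr2 ler_wpM2l //; lra.
have : d * (a + b) <= e.
  by rewrite /d mulrAC ler_pdivrMr ?ler_wpM2l //; lra.
lra.
Qed.

Lemma dotp_weighted_AMGM (a b : 'rV[R]_3) (s : R) : 0 < s ->
  2 * `|dotp a b| <= s * dotp a a + s^-1 * dotp b b.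
Proof.
move=> s0; rewrite /dotp !mulr_sumr -big_split /=.
apply: le_trans (ler_wpM2l _ (ler_norm_sum _ _ _)) _ => //.
rewrite mulr_sumr; apply: ler_sum => k _; rewrite normrM -!expr2.
rewrite -[a 0 k ^+ 2]real_normK ?num_real // -[b 0 k ^+ 2]real_normK ?num_real //.
set x := `|_|; set y := `|_|; rewrite -subr_ge0.
suff -> : s * x ^+ 2 + s^-1 * y ^+ 2 - 2 * (x * y) = s^-1 * (s * x - y) ^+ 2.
  by rewrite mulr_ge0 ?sqr_ge0 // invr_ge0 ltW.
by field; rewrite gt_eqF.
Qed.

Definition wform D w u v : R := \int[mu]_(x in D) (w x * dotp (u x) (v x)).

Section Form.
Variables (D : set T) (w : T -> R) (M : R).
Hypotheses (mD : measurable D) (mw : measurable_fun D w)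
  (wM : forall x, D x -> `|w x| <= M) (M0 : 0 < M).

Lemma integrable_wdotp u v : sqint D u -> sqint D v ->
  mu.-integrable D (EFin \o (fun x => w x * dotp (u x) (v x))).
Proof. by move=> Lu Lv; apply: integrable_weighted wM _ => //; exact: integrable_dotp. Qed.

Lemma wformBl u u' v : sqint D u -> sqint D u' -> sqint D v ->
  wform D w (u - u') v = wform D w u v - wform D w u' v.
Proof.
move=> Lu Lu' Lv; rewrite /wform -RintegralB //; [|exact: integrable_wdotp..].
apply: eq_Rintegral => x _; rewrite -mulrBr; congr (_ * _).
by rewrite /dotp -sumrB; apply: eq_bigr => k _; rewrite !mxE mulrBl.
Qed.

Lemma wformBr u v v' : sqint D u -> sqint D v -> sqint D v' ->
  wform D w u (v - v') = wform D w u v - wform D w u v'.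
Proof.
move=> Lu Lv Lv'; rewrite /wform -RintegralB //; [|exact: integrable_wdotp..].
apply: eq_Rintegral => x _; rewrite -mulrBr; congr (_ * _).
by rewrite /dotp -sumrB; apply: eq_bigr => k _; rewrite !mxE mulrBr.
Qed.

(** Cauchy-Schwarz, obtained by integrating the pointwise weighted AM-GM
    inequality and then optimising its parameter; the weight costs its
    supremum. *)
Lemma wform_le u v : sqint D u -> sqint D v ->
  `|wform D w u v| <= M * (l2norm D u * l2norm D v).
Proof.
move=> Lu Lv.
rewrite -ler_pdivrMl //; apply: le_mul_of_weighted_sum; rewrite ?l2norm_ge0 // => s s0.
have iu := integrable_dotp mD Lu Lu; have iv := integrable_dotp mD Lv Lv.
have isu : mu.-integrable D (EFin \o (fun x => s * dotp (u x) (u x))).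
  exact: (integrableZl mD s iu).
have isv : mu.-integrable D (EFin \o (fun x => s^-1 * dotp (v x) (v x))).
  exact: (integrableZl mD s^-1 iv).
rewrite !sqr_l2norm -!RintegralZl // -RintegralD //.
rewrite mulrCA ler_pdivrMl // -ler_pdivlMl // mulrA -RintegralZl //; last first.
  exact: (integrableD mD isu isv).
apply: le_trans (le_normr_Rintegral mD (integrable_wdotp Lu Lv)) _.
apply: le_Rintegral => //.
- exact: (integrable_norm (integrable_wdotp Lu Lv)).
- exact: (integrableZl mD (2^-1 * M) (integrableD mD isu isv)).
move=> x Dx; rewrite normrM -mulrA mulrCA.
apply: ler_pM => //; first exact: wM.
by rewrite ler_pdivlMl //; exact: dotp_weighted_AMGM.
Qed.

(** The difference expands exactly around (u', v') into three pairings, each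
    containing u' - u or v' - v, to which Cauchy-Schwarz applies. *)
Lemma wform_perturb u u' v v' (e : R) :
    sqint D u -> sqint D u' -> sqint D v -> sqint D v' ->
    l2norm D (u' - u) <= e -> l2norm D (v' - v) <= e ->
  `|wform D w u v - wform D w u' v'|
    <= M * (e * (e + l2norm D u' + l2norm D v')).
Proof.
move=> Lu Lu' Lv Lv' hu hv.
have Lp := sqintB mD Lu' Lu; have Lq := sqintB mD Lv' Lv.
have -> : wform D w u v - wform D w u' v' =
    wform D w (u' - u) (v' - v) - wform D w (u' - u) v' - wform D w u' (v' - v).
  by rewrite !wformBr ?wformBl //; ring.
have e0 : 0 <= e := le_trans (l2norm_ge0 _ _) hu.
have h1 : `|wform D w (u' - u) (v' - v)| <= M * (e * e).
  apply: le_trans (wform_le Lp Lq) _.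
  by rewrite ler_wpM2l ?ler_pM ?l2norm_ge0 // ltW.
have h2 : `|wform D w (u' - u) v'| <= M * (e * l2norm D v').
  apply: le_trans (wform_le Lp Lv') _.
  by rewrite ler_wpM2l ?ler_pM ?l2norm_ge0 // ltW.
have h3 : `|wform D w u' (v' - v)| <= M * (e * l2norm D u').
  apply: le_trans (wform_le Lu' Lq) _.
  by rewrite ler_wpM2l ?[e * _]mulrC ?ler_pM ?l2norm_ge0 // ltW.
apply: le_trans (ler_normB _ _) _; apply: le_trans (lerD (ler_normB _ _) (lexx _)) _.
move: h1 h2 h3; lra.
Qed.
End Form.

Lemma l2norm_triangle D u v : measurable D -> sqint D u -> sqint D v ->
  l2norm D (u + v) <= l2norm D u + l2norm D v.
Proof.
move=> mD Lu Lv.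
rewrite -(@ler_pXn2r _ 2) ?nnegrE ?addr_ge0 ?l2norm_ge0 //.
have iuv := integrable_dotp mD Lu Lv.
have iu := integrable_dotp mD Lu Lu; have iv := integrable_dotp mD Lv Lv.
have -> : l2norm D (u + v) ^+ 2 =
    l2norm D u ^+ 2 + 2 * wform D (fun=> 1) u v + l2norm D v ^+ 2.
  rewrite !sqr_l2norm /wform.
  under [X in _ = _ + 2 * X + _]eq_Rintegral do rewrite mul1r.
  rewrite -RintegralZl // -!RintegralD //=.
  - apply: eq_Rintegral => x _; rewrite /dotp mulr_sumr -!big_split /=.
    by apply: eq_bigr => k _; rewrite !mxE; ring.
  - exact: (integrableD mD iu (integrableZl mD 2 iuv)).
  - exact: (integrableZl mD 2 iuv).
have := @wform_le D (fun=> 1) 1 mD _ _ _ u v Lu Lv.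
rewrite mul1r => /(_ (measurable_cst _) _ ltr01) h.
have {}h := le_trans (ler_norm _) (h (fun _ _ => _)).
by rewrite sqrrD; have := h ltac:(by rewrite normr1); lra.
Qed.
End Weighted_L2.

(** * Fields on the Euclidean space, real and complex *)

Section Euclidean_L2.
Context {R : realType}.
Implicit Types (D E : set (pt R)) (u v : vfield R R) (w : pt R -> R).

(** The carrier of [leb3 R] with its own measurable structure. *)
Notation space := (measurableTypeR R * measurableTypeR R * measurableTypeR R)%type.

Definition leb3_measure : {measure set space -> \bar R} := leb3 R.

Lemma L2D D u v : measurable D -> L2 D u -> L2 D v -> L2 D (u + v).
Proof. exact: (@sqintD _ space R leb3_measure). Qed.

Lemma L2S D E u : measurable D -> measurable E -> E `<=` D -> L2 D u -> L2 E u.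
Proof. exact: (@sqintS _ space R leb3_measure). Qed.

Lemma L2normS D E u : measurable D -> measurable E -> E `<=` D -> L2 D u ->
  L2norm E u <= L2norm D u.
Proof. exact: (@l2normS _ space R leb3_measure). Qed.

Lemma L2norm_subC D u v : L2norm D (u - v) = L2norm D (v - u).
Proof.
congr Num.sqrt; apply: eq_Rintegral => x _; rewrite /dotp.
by apply: eq_bigr => k _; rewrite !mxE; ring.
Qed.

Lemma L2_wform_perturb D w (M e : R) u u' v v' :
    measurable D -> measurable_fun D w -> (forall x, D x -> `|w x| <= M) ->
    0 < M -> L2 D u -> L2 D u' -> L2 D v -> L2 D v' ->
    L2norm D (u' - u) <= e -> L2norm D (v' - v) <= e ->
  `|\int[leb3 R]_(x in D) (w x * dotp (u x) (v x))
    - \int[leb3 R]_(x in D) (w x * dotp (u' x) (v' x))|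
    <= M * (e * (e + L2norm D u' + L2norm D v')).
Proof.
move=> mD mw wM M0 Lu Lu' Lv Lv' hu hv.
exact: (@wform_perturb _ space R leb3_measure D w M mD mw wM M0
  u u' v v' e Lu Lu' Lv Lv' hu hv).
Qed.

Lemma L2_triangle D u v : measurable D -> L2 D u -> L2 D v ->
  L2norm D (u + v) <= L2norm D u + L2norm D v.
Proof. exact: (@l2norm_triangle _ space R leb3_measure). Qed.

Definition L2C D (u : vfield R R[i]) : Prop :=
  L2 D (re_field u) /\ L2 D (im_field u).

Lemma normC_le (z : R[i]) : `|z| <= (`|complex.Re z| + `|complex.Im z|)%:C%C.
Proof.
case: z => x y; rewrite normc_def lecR /=.
rewrite -[leRHS]ger0_norm ?addr_ge0 // -sqrtr_sqr; apply: ler_wsqrtr.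
rewrite sqrrD !real_normK ?num_real //.
have : 0 <= `|x| * `|y| by rewrite mulr_ge0. lra.
Qed.

(** With a, b, c, d the four real pairings that make up a complex one, each real
    and imaginary part collects two of them, so that four errors add up. *)
Lemma normC_sesqui_le (a b c d a' b' c' d' K : R) :
    `|a - a'| <= K -> `|b - b'| <= K -> `|c - c'| <= K -> `|d - d'| <= K ->
  `|((a + b) +i* (c - d))%C - ((a' + b') +i* (c' - d'))%C| <= (4 * K)%:C%C.
Proof.
move=> ha hb hc hd; apply: le_trans (normC_le _) _; rewrite lecR /=.
have -> : 4 * K = K + K + (K + K) by ring.
apply: lerD.
  by rewrite opprD addrACA (le_trans (ler_normD _ _)) // lerD.
have -> : c - d - (c' - d') = (c - c') - (d - d') by ring.
by rewrite (le_trans (ler_normB _ _)) // lerD.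
Qed.

Lemma Re_scale (a : R) (z : R[i]) : complex.Re (a%:C%C * z) = a * complex.Re z.
Proof. by case: z => x y /=; rewrite mul0r subr0. Qed.

Lemma Im_scale (a : R) (z : R[i]) : complex.Im (a%:C%C * z) = a * complex.Im z.
Proof. by case: z => x y /=; rewrite mul0r addr0. Qed.

Lemma dotp_conj_Re (u v : vfield R R[i]) x :
  dotp (re_field u x) (re_field v x) + dotp (im_field u x) (im_field v x)
  = complex.Re (dotp (u x) (conj_vec (v x))).
Proof.
rewrite /dotp raddf_sum -big_split /=; apply: eq_bigr => k _; rewrite !mxE.
by case: (u x 0 k) (v x 0 k) => a b [c d] /=; ring.
Qed.

Lemma dotp_conj_Im (u v : vfield R R[i]) x :
  dotp (im_field u x) (re_field v x) - dotp (re_field u x) (im_field v x)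
  = complex.Im (dotp (u x) (conj_vec (v x))).
Proof.
rewrite /dotp -sumrB raddf_sum; apply: eq_bigr => k _; rewrite !mxE.
by case: (u x 0 k) (v x 0 k) => a b [c d] /=; ring.
Qed.

(** The real and imaginary parts of a sesquilinear pairing in terms of real
    bilinear ones, to which the real estimate applies. *)
Lemma cform_split D w (u v : vfield R R[i]) M : measurable D ->
    measurable_fun D w -> (forall x, D x -> `|w x| <= M) ->
    L2C D u -> L2C D v ->
  cintegral D (fun x => (w x)%:C%C * dotp (u x) (conj_vec (v x))) =
  ((\int[leb3 R]_(x in D) (w x * dotp (re_field u x) (re_field v x))
    + \int[leb3 R]_(x in D) (w x * dotp (im_field u x) (im_field v x)))
   +i* (\int[leb3 R]_(x in D) (w x * dotp (im_field u x) (re_field v x))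
    - \int[leb3 R]_(x in D) (w x * dotp (re_field u x) (im_field v x))))%C.
Proof.
move=> mD mw wM [Lur Lui] [Lvr Lvi].
have I (f g : vfield R R) (Lf : L2 D f) (Lg : L2 D g) :=
  @integrable_wdotp _ space R leb3_measure D w M mD mw wM f g Lf Lg.
rewrite -(@RintegralD _ space R leb3_measure D _ _ mD (I _ _ Lur Lvr) (I _ _ Lui Lvi)).
rewrite -(@RintegralB _ space R leb3_measure D _ _ mD (I _ _ Lui Lvr) (I _ _ Lur Lvi)).
rewrite /cintegral; congr (_ +i* _)%C; apply: eq_Rintegral => x _.
- by rewrite -mulrDr dotp_conj_Re Re_scale.
- by rewrite -mulrBr dotp_conj_Im Im_scale.
Qed.

(** Bounds n and m replace the norms of u' and v', so that a known source field
    may be added to both arguments and estimated afterwards. *)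
Lemma cform_perturb D w (M e n m : R) (u u' v v' : vfield R R[i]) :
    measurable D -> measurable_fun D w -> (forall x, D x -> `|w x| <= M) ->
    0 < M -> L2C D u -> L2C D u' -> L2C D v -> L2C D v' ->
    L2norm D (re_field u' - re_field u) <= e ->
    L2norm D (im_field u' - im_field u) <= e ->
    L2norm D (re_field v' - re_field v) <= e ->
    L2norm D (im_field v' - im_field v) <= e ->
    L2norm D (re_field u') <= n -> L2norm D (im_field u') <= n ->
    L2norm D (re_field v') <= m -> L2norm D (im_field v') <= m ->
  `|cintegral D (fun x => (w x)%:C%C * dotp (u x) (conj_vec (v x)))
    - cintegral D (fun x => (w x)%:C%C * dotp (u' x) (conj_vec (v' x)))|
    <= (4 * (M * (e * (e + n + m))))%:C%C.
Proof.
move=> mD mw wM M0 Lu Lu' Lv Lv' hur hui hvr hvi nur nui nvr nvi.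
rewrite !(cform_split mD mw wM) //.
case: Lu Lu' Lv Lv' => [Lur Lui] [Lur' Lui'] [Lvr Lvi] [Lvr' Lvi'].
have e0 : 0 <= e := le_trans (sqrtr_ge0 _) hur.
have P (f f' g g' : vfield R R) : L2 D f -> L2 D f' -> L2 D g -> L2 D g' ->
    L2norm D (f' - f) <= e -> L2norm D (g' - g) <= e ->
    L2norm D f' <= n -> L2norm D g' <= m ->
  `|\int[leb3 R]_(x in D) (w x * dotp (f x) (g x))
    - \int[leb3 R]_(x in D) (w x * dotp (f' x) (g' x))|
    <= M * (e * (e + n + m)).
  move=> Lf Lf' Lg Lg' hf hg nf ng.
  apply: le_trans (L2_wform_perturb mD mw wM M0 Lf Lf' Lg Lg' hf hg) _.
  by rewrite ler_wpM2l ?(ltW M0) // ler_wpM2l // !lerD.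
have p1 := P _ _ _ _ Lur Lur' Lvr Lvr' hur hvr nur nvr.
have p2 := P _ _ _ _ Lui Lui' Lvi Lvi' hui hvi nui nvi.
have p3 := P _ _ _ _ Lui Lui' Lvr Lvr' hui hvr nui nvr.
have p4 := P _ _ _ _ Lur Lur' Lvi Lvi' hur hvi nur nvi.
exact: normC_sesqui_le p1 p2 p3 p4.
Qed.

(** 1 / mu is a constant plus a multiple of the indicator of B. *)
Lemma measurable_mu_tilde_inv B D (mur : R) : measurable B ->
  measurable_fun D (fun x => (mu_tilde B mur x)^-1).
Proof.
move=> mB.
have -> : (fun x => (mu_tilde B mur x)^-1) = (fun x => 1 + (mur^-1 - 1) * \1_B x).
  apply/funext => x; rewrite /mu_tilde indicE; case: ifP => _ /=.
    by rewrite mulr1 addrC subrK.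
  by rewrite mulr0 addr0 invr1.
by apply: measurable_funD => //; apply: measurable_funM.
Qed.

Lemma mu_tilde_inv_le B (mur : R) x : 0 < mur ->
  `|(mu_tilde B mur x)^-1| <= 1 + mur^-1.
Proof.
move=> m0; have i0 : 0 < mur^-1 by rewrite invr_gt0.
by rewrite /mu_tilde; case: ifP => _; rewrite ?invr1 ?normr1 ?ger0_norm ?ltW //;
  lra.
Qed.

Lemma measurable_xi (k : 'I_3) D : measurable_fun D (fun x : pt R => xi x 0 k).
Proof.
apply: (@measurable_funS _ _ _ _ setT) => //.
under eq_fun do rewrite /xi mxE.
have m11 : measurable_fun setT (fun x : pt R => x.1.1).
  exact: (measurableT_comp measurable_fst measurable_fst).
have m12 : measurable_fun setT (fun x : pt R => x.1.2).
  exact: (measurableT_comp measurable_snd measurable_fst).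
by case: k => -[|[|[|]]] //= _; exact: measurable_snd.
Qed.

Lemma xi_le (x : pt R) k : `|xi x 0 k| <= `|x|.
Proof.
rewrite /xi mxE !prod_normE !le_max.
case: k => -[|[|[|]]] //= _; rewrite lexx ?orbT //.
Qed.

(** The components of e_i x xi are bounded on D and D has finite measure. *)
Lemma L2_rotation D i : measurable D -> bounded_set D ->
  L2 D (fun x => cross (evec R i) (xi x)).
Proof.
move=> mD bD k.
have mc : measurable_fun D (fun x => cross (evec R i) (xi x) 0 k).
  under eq_fun do rewrite /cross mxE.
  by apply: measurable_funB; apply: measurable_funM => //; exact: measurable_xi.
split=> //.
apply: (@measurable_bounded_integrable _ space R leb3_measure
  (fun x => cross (evec R i) (xi x) 0 k ^+ 2) D mD).
- exact: bounded_finite_leb3.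
- exact: measurable_funX.
case: bD => M [Mr MD].
exists ((2 * (`|M| + 1)) ^+ 2); split; first exact: num_real.
move=> y hy x Dx; apply: le_trans (ltW hy).
have MM : M < `|M| + 1 by rewrite (le_lt_trans (ler_norm M)) // ltrDl.
have xM : `|x| <= `|M| + 1 := MD _ MM x Dx.
rewrite /= normrX ler_pXn2r ?nnegrE ?mulr_ge0 ?addr_ge0 //.
rewrite mxE mulr2n mulrDl mul1r.
have term (a : R) l : `|a| <= 1 -> `|a * xi x 0 l| <= `|M| + 1.
  move=> a1; rewrite normrM -[leRHS]mul1r ler_pM //.
  exact: le_trans (xi_le _ _) xM.
have evec_le l : `|evec R i 0 l| <= 1.
  by rewrite mxE; case: (_ && _); rewrite ?normr0 ?normr1 // ler01.
by rewrite (le_trans (ler_normB _ _)) // lerD // term.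
Qed.

Lemma le_hypotl (a b : R) : 0 <= a -> a <= Num.sqrt (a ^+ 2 + b ^+ 2).
Proof.
move=> a0; rewrite -[leLHS]ger0_norm // -sqrtr_sqr; apply: ler_wsqrtr.
by rewrite lerDl sqr_ge0.
Qed.

Lemma le_hypotr (a b : R) : 0 <= b -> b <= Num.sqrt (a ^+ 2 + b ^+ 2).
Proof. by rewrite addrC; exact: le_hypotl. Qed.

Lemma L2normC_ge_re D (u : vfield R R[i]) : L2norm D (re_field u) <= L2normC D u.
Proof. exact: le_hypotl (sqrtr_ge0 _). Qed.

Lemma L2normC_ge_im D (u : vfield R R[i]) : L2norm D (im_field u) <= L2normC D u.
Proof. exact: le_hypotr (sqrtr_ge0 _). Qed.

Lemma L2norm_curlB_le D (u v : hfield R) :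
  L2norm D (u.2 - v.2) <= Hcurl_norm D (u - v).
Proof. exact: (@le_hypotr (L2norm D (u - v).1) _ (sqrtr_ge0 _)). Qed.

Lemma L2normCB_le D (u v : hfieldC R) :
  L2normC D (u.1 - v.1) <= Hcurl_normC D (u - v).
Proof. exact: (@le_hypotl _ (L2normC D (u - v).2) (sqrtr_ge0 _)). Qed.

Lemma L2normC_curlB_le D (u v : hfieldC R) :
  L2normC D (u.2 - v.2) <= Hcurl_normC D (u - v).
Proof. exact: (@le_hypotr (L2normC D (u - v).1) _ (sqrtr_ge0 _)). Qed.

Lemma re_fieldB (u v : vfield R R[i]) : re_field (u - v) = re_field u - re_field v.
Proof. by apply/funext => x; apply/rowP => k; rewrite !fctE !mxE /= raddfB. Qed.

Lemma im_fieldB (u v : vfield R R[i]) : im_field (u - v) = im_field u - im_field v.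
Proof. by apply/funext => x; apply/rowP => k; rewrite !fctE !mxE /= raddfB. Qed.

(** * Perturbation of the tensor coefficients *)

(** Moves the constant K of an error bound K e out of the quadratic expression:
    the difference of the two sides is K (K - 1) e s. *)
Lemma quadratic_absorb (K e s : R) : 1 <= K -> 0 <= e -> 0 <= s ->
  K * e * (K * e + s) <= K ^+ 2 * (e * (e + s)).
Proof.
move=> K1 e0 s0; rewrite -subr_ge0.
have -> : K ^+ 2 * (e * (e + s)) - K * e * (K * e + s) = K * e * s * (K - 1).
  by ring.
by rewrite !mulr_ge0 // ?subr_ge0 // (le_trans ler01).
Qed.

Lemma L2normCS D E (u : vfield R R[i]) : measurable D -> measurable E ->
  E `<=` D -> L2C D u -> L2normC E u <= L2normC D u.
Proof.
move=> mD mE ED [ur ui]; apply: ler_wsqrtr.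
by apply: lerD; rewrite ler_pXn2r ?nnegrE ?sqrtr_ge0 //; exact: L2normS.
Qed.

Lemma L2CB D (u v : vfield R R[i]) : measurable D ->
  L2C D u -> L2C D v -> L2C D (u - v).
Proof.
move=> mD [ur ui] [vr vi]; split; rewrite ?re_fieldB ?im_fieldB;
  exact: (@sqintB _ space R leb3_measure).
Qed.

Lemma L2CS D E (u : vfield R R[i]) : measurable D -> measurable E ->
  E `<=` D -> L2C D u -> L2C E u.
Proof. by move=> mD mE ED [ur ui]; split; exact: L2S ED _. Qed.

Lemma L2normC_subC D (u v : vfield R R[i]) : L2normC D (u - v) = L2normC D (v - u).
Proof.
rewrite /L2normC !re_fieldB !im_fieldB.
by rewrite (L2norm_subC D (re_field u)) (L2norm_subC D (im_field u)).
Qed.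

Section Coefficients.
Variables (Omega B : set (pt R)) (mur alpha : R).
Hypotheses (mO : measurable Omega) (mB : measurable B) (mur0 : 0 < mur)
  (alpha0 : 0 < alpha).

Let M0 : 0 < 1 + mur^-1.
Proof. by rewrite addr_gt0 ?invr_gt0. Qed.

(** The summand with the Kronecker delta does not depend on the fields and
    cancels in the difference. *)
Lemma N0_perturb (K e : R) (tt tt' : 'I_3 -> hfield R) i j :
    1 <= K -> 0 <= e ->
    (forall k, L2 Omega (tt k).2) -> (forall k, L2 Omega (tt' k).2) ->
    (forall k, L2norm Omega ((tt' k).2 - (tt k).2) <= K * e) ->
  `|N0 Omega B mur alpha tt i j - N0 Omega B mur alpha tt' i j|
    <= alpha ^+ 3 * ((1 + mur^-1) * (K ^+ 2
       * (e * (e + L2norm Omega (tt' i).2 + L2norm Omega (tt' j).2)))).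
Proof.
move=> K1 e0 Lt Lt' ht; rewrite /N0 opprD addrACA subrr add0r -mulrBr.
have a3 : 0 <= alpha ^+ 3 by rewrite exprn_ge0 // ltW.
rewrite normrM ger0_norm ?divr_ge0 //.
apply: ler_pM; rewrite ?divr_ge0 //.
  by rewrite ler_pdivrMr // ler_peMr // ler1n.
apply: le_trans (L2_wform_perturb mO (@measurable_mu_tilde_inv B Omega mur mB)
  (fun x _ => mu_tilde_inv_le B x mur0) M0 (Lt i) (Lt' i) (Lt j) (Lt' j)
  (ht i) (ht j)) _.
rewrite ler_wpM2l ?(ltW M0) // -!addrA; apply: quadratic_absorb => //.
by rewrite addr_ge0 ?sqrtr_ge0.
Qed.

Let norm_scale (z : R[i]) (b : R) : `|z| <= (4 * b)%:C%C ->
  `|(alpha ^+ 3 / 4)%:C%C * z| <= (alpha ^+ 3 * b)%:C%C.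
Proof.
have a3 : 0 <= alpha ^+ 3 by rewrite exprn_ge0 // ltW.
have a4 : 0 <= (alpha ^+ 3 / 4)%:C%C :> R[i] by rewrite ler0c divr_ge0.
move=> zb; rewrite normrM ger0_norm //.
have -> : alpha ^+ 3 * b = (alpha ^+ 3 / 4) * (4 * b) by field.
by rewrite [leRHS]rmorphM ler_wpM2l.
Qed.

Let reim_close D (u u' : vfield R R[i]) (e : R) : L2normC D (u' - u) <= e ->
  L2norm D (re_field u' - re_field u) <= e
  /\ L2norm D (im_field u' - im_field u) <= e.
Proof.
move=> h; rewrite -re_fieldB -im_fieldB.
by split; apply: le_trans h; [exact: L2normC_ge_re|exact: L2normC_ge_im].
Qed.

Lemma Rcoef_perturb (K e : R) (th th' : 'I_3 -> hfieldC R) i j :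
    1 <= K -> 0 <= e ->
    (forall k, L2C Omega (th k).2) -> (forall k, L2C Omega (th' k).2) ->
    (forall k, L2normC Omega ((th' k).2 - (th k).2) <= K * e) ->
  `|Rcoef Omega B mur alpha th i j - Rcoef Omega B mur alpha th' i j|
    <= (alpha ^+ 3 * ((1 + mur^-1) * (K ^+ 2
       * (e * (e + L2normC Omega (th' i).2 + L2normC Omega (th' j).2)))))%:C%C.
Proof.
move=> K1 e0 Lt Lt' ht; rewrite /Rcoef -opprD normrN -mulrBr.
apply: norm_scale.
have [hri hii] := reim_close (ht i); have [hrj hij] := reim_close (ht j).
apply: le_trans (cform_perturb mO (@measurable_mu_tilde_inv B Omega mur mB)
  (fun x _ => mu_tilde_inv_le B x mur0) M0 (Lt i) (Lt' i) (Lt j) (Lt' j)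
  hri hii hrj hij (L2normC_ge_re _ _) (L2normC_ge_im _ _)
  (L2normC_ge_re _ _) (L2normC_ge_im _ _)) _.
rewrite lecR ler_wpM2l // ler_wpM2l ?(ltW M0) // -!addrA.
by apply: quadratic_absorb; rewrite ?addr_ge0 ?sqrtr_ge0.
Qed.

(** Adding th0 leaves the differences of the fields unchanged and increases each
    norm by at most t; being real, th0 contributes to the real parts only. *)
Lemma Icoef_perturb (nu K e t : R) (th0 : 'I_3 -> vfield R R)
    (th th' : 'I_3 -> hfieldC R) i j :
    0 < nu -> 1 <= K -> 0 <= e ->
    (forall k, L2 B (th0 k)) -> (forall k, L2norm B (th0 k) <= t) ->
    (forall k, L2C B (th k).1) -> (forall k, L2C B (th' k).1) ->
    (forall k, L2normC B ((th' k).1 - (th k).1) <= K * e) ->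
  `|Icoef B nu alpha th0 th i j - Icoef B nu alpha th0 th' i j|
    <= (alpha ^+ 3 * (nu * (K ^+ 2
       * (e * (e + (L2normC B (th' i).1 + t + (L2normC B (th' j).1 + t)))))))%:C%C.
Proof.
move=> nu0 K1 e0 L0 h0 Lt Lt' ht; rewrite /Icoef -mulrBr; apply: norm_scale.
have reD (u : vfield R R[i]) k :
    re_field (u + to_complex (th0 k)) = re_field u + th0 k.
  by apply/funext => x; apply/rowP => l; rewrite !fctE !mxE; case: (u x 0 l).
have imD (u : vfield R R[i]) k :
    im_field (u + to_complex (th0 k)) = im_field u.
  apply/funext => x; apply/rowP => l; rewrite !fctE !mxE.
  by case: (u x 0 l) => a b /=; rewrite addr0.
have LD (u : vfield R R[i]) k : L2C B u -> L2C B (u + to_complex (th0 k)).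
  by move=> [Lr Li]; split; rewrite ?reD ?imD //; exact: L2D.
have hr k : L2norm B (re_field ((th' k).1 + to_complex (th0 k))
    - re_field ((th k).1 + to_complex (th0 k))) <= K * e.
  rewrite !reD (_ : _ - _ = re_field (th' k).1 - re_field (th k).1).
    by have [] := reim_close (ht k).
  by rewrite opprD addrACA subrr addr0.
have hi k : L2norm B (im_field ((th' k).1 + to_complex (th0 k))
    - im_field ((th k).1 + to_complex (th0 k))) <= K * e.
  by rewrite !imD; have [] := reim_close (ht k).
have t0 : 0 <= t := le_trans (sqrtr_ge0 _) (h0 i).
have nr k : L2norm B (re_field ((th' k).1 + to_complex (th0 k)))
    <= L2normC B (th' k).1 + t.
  rewrite reD; apply: le_trans (L2_triangle mB (Lt' k).1 (L0 k)) _.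
  by rewrite lerD ?L2normC_ge_re.
have ni k : L2norm B (im_field ((th' k).1 + to_complex (th0 k)))
    <= L2normC B (th' k).1 + t.
  by rewrite imD -[leLHS]addr0 lerD ?L2normC_ge_im.
apply: le_trans (@cform_perturb B (fun=> nu) nu (K * e) _ _ _ _ _ _ mB
  (measurable_cst _) _ nu0 (LD _ i (Lt i)) (LD _ i (Lt' i)) (LD _ j (Lt j))
  (LD _ j (Lt' j)) (hr i) (hi i) (hr j) (hi j) (nr i) (ni i) (nr j) (ni j)) _.
  by move=> x _; rewrite ger0_norm // ltW.
rewrite lecR ler_wpM2l // ler_wpM2l ?(ltW nu0) // -[X in _ * X <= _]addrA.
by apply: quadratic_absorb; rewrite ?addr_ge0 ?sqrtr_ge0.
Qed.
End Coefficients.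
End Euclidean_L2.

(** * The error estimates *)

Theorem theorem5p5 (R : realType) (Omega B : set (pt R)) (mur C0 : R)
    (tt : 'I_3 -> hfield R)
    (hOmega : bounded_lipschitz_polyhedron Omega)
    (hOmega_convex : convex_set Omega)
    (hB : bounded_lipschitz_polyhedron B)
    (hBOmega : closure B `<=` Omega)
    (hmur : 0 < mur)
    (htt : forall i, solves_theta0 Omega B mur 0 (X Omega B) i (tt i)) :
  exists2 C1 : R, 0 < C1 &
  forall eps alpha vt k0 a0 : R,
  0 < eps -> 0 < alpha -> 0 < vt -> 0 < k0 -> 0 < a0 ->
  exists2 C2N : R, 0 < C2N &
  forall nu k1 a1 : R, 0 < nu -> 0 < k1 -> 0 < a1 ->
  exists2 C2 : R, 0 < C2 &
  forall (tte : 'I_3 -> hfield R) (th the : 'I_3 -> hfieldC R),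
  (forall i, solves_theta0 Omega B mur eps (Xeps Omega) i (tte i)) ->
  (forall i, solves_theta1 Omega B mur nu 0 (complexify (X Omega B))
               (theta0 tt i) (th i)) ->
  (forall i, solves_theta1 Omega B mur nu eps (complexify (Xeps Omega))
               (theta0 tt i) (the i)) ->
  (forall i, Hcurl_norm Omega (tte i - tt i) <= C0 * eps) ->
  (forall i, Hcurl_normC Omega (the i - th i) <= C0 * eps * nu) ->
  forall (h : R) (p Ndof : nat) (phi : 'I_Ndof -> hfield R)
    (tthp : 'I_3 -> hfield R) (thhp : 'I_3 -> hfieldC R),
  is_hp_basis Omega h p phi ->
  (forall i, solves_theta0 Omega B mur eps (Xhp Omega phi `&` Xeps Omega) i
               (tthp i)) ->
  (forall i, solves_theta1 Omega B mur nu eps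
               (complexify (Xhp Omega phi `&` Xeps Omega))
               (theta0 tt i) (thhp i)) ->
  let E0 := expR (- (a0 * Ndof%:R `^ vt)) in
  let E1 := expR (- (a1 * Ndof%:R `^ vt)) in
  (forall i, Hcurl_norm Omega (tte i - tthp i) <= k0 * E0) ->
  (forall i, Hcurl_normC Omega (the i - thhp i) <= k1 * E1) ->
  forall i j : 'I_3,
  [/\ `|N0 Omega B mur alpha tt i j - N0 Omega B mur alpha tthp i j|
        <= C1 * eps * alpha ^+ 3
             * (eps + L2norm Omega (tte i).2 + L2norm Omega (tte j).2)
           + C2N * E0
             * (E0 + L2norm Omega (tthp i).2 + L2norm Omega (tthp j).2),
      `|Rcoef Omega B mur alpha th i j - Rcoef Omega B mur alpha thhp i j|
        <= (C1 * eps * nu * alpha ^+ 3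
              * (eps * nu + L2normC Omega (the i).2 + L2normC Omega (the j).2)
            + C2 * E1
              * (E1 + L2normC Omega (thhp i).2 + L2normC Omega (thhp j).2)
           )%:C%C &
      `|Icoef B nu alpha (theta0 tt) th i j
          - Icoef B nu alpha (theta0 tt) thhp i j|
        <= (C1 * eps * nu ^+ 2 * alpha ^+ 3
              * (1 + eps * nu + L2normC B (the i).1 + L2normC B (the j).1)
            + C2 * E1
              * (1 + E1 + L2normC B (thhp i).1 + L2normC B (thhp j).1)
           )%:C%C].
Proof.
case: hOmega => oO _ _ _ _; case: hB => oB _ bB _ _.
have mO := open_measurable3 oO; have mB := open_measurable3 oB.
have BO : B `<=` Omega := subset_trans (@subset_closure _ B) hBOmega.
have XL u : Xeps Omega u -> L2 Omega u.1 /\ L2 Omega u.2 by move=> [[]].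
have XCL u : complexify (Xeps Omega) u -> L2C Omega u.1 /\ L2C Omega u.2.
  by move=> [/XL[? ?] /XL[? ?]].
have L0 k : L2 B (theta0 tt k).
  have [/(XL _)[Ltt _] _] := (htt k).1.
  exact: (L2D mB (L2S mO mB BO Ltt) (L2_rotation k mB bB)).
(* A bound on the source norms that depends on neither eps nor nu nor alpha, as
   required of a quantity entering C1. *)
pose t := \sum_k L2norm B (theta0 tt k).
have t0 : 0 <= t by apply: sumr_ge0 => k _; exact: sqrtr_ge0.
have ht k : L2norm B (theta0 tt k) <= t.
  by rewrite /t (bigD1 k) //= lerDl sumr_ge0 // => l _; exact: sqrtr_ge0.
(* 1 + |C0| rather than C0: the constant must be at least 1 to be absorbed, and
   nothing is assumed on the sign of C0. *)
pose M := 1 + mur^-1; pose K := 1 + `|C0|.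
have M1 : 1 <= M by rewrite lerDl invr_ge0 ltW.
have K1 : 1 <= K by rewrite lerDl.
have T1 : 1 <= 1 + 2 * t by rewrite lerDl mulr_ge0.
have [M0 K0 T0] : [/\ 0 < M, 0 < K & 0 < 1 + 2 * t].
  by split; apply: lt_le_trans ltr01 _.
exists (M * K ^+ 2 * (1 + 2 * t)); first by rewrite !mulr_gt0 // exprn_gt0.
move=> eps alpha vt k0 a0 eps0 alpha0 vt0 k00 a00.
exists (alpha ^+ 3 * M * (1 + k0) ^+ 2).
  by rewrite !mulr_gt0 ?exprn_gt0 // addr_gt0.
move=> nu k1 a1 nu0 k10 a10.
(* The factor M (1 + nu) dominates both the weight M of R and the weight nu
   of I. *)
exists (alpha ^+ 3 * (M * (1 + nu)) * (1 + k1) ^+ 2 * (1 + 2 * t)).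
  by rewrite !mulr_gt0 ?exprn_gt0 // addr_gt0.
move=> tte th the htte hth hthe dtt dth h p Ndof phi tthp thhp _ htthp hthhp.
move=> E0 E1 dtthp dthhp i j.
have E00 : 0 < E0 by exact: expR_gt0.
have E10 : 0 < E1 by exact: expR_gt0.
have Ltt k : L2 Omega (tt k).2 by have [/(XL _)[]] := (htt k).1.
have Ltte k : L2 Omega (tte k).2 by have [] := XL _ (htte k).1.
have Ltthp k : L2 Omega (tthp k).2 by have [_ /(XL _)[]] := (htthp k).1.
have Lth k : L2C Omega (th k).1 /\ L2C Omega (th k).2.
  by apply: XCL; have [[? _] [? _]] := (hth k).1.
have Lthe k : L2C Omega (the k).1 /\ L2C Omega (the k).2 by exact: XCL (hthe k).1.
have Lthhp k : L2C Omega (thhp k).1 /\ L2C Omega (thhp k).2.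
  by apply: XCL; have [[_ ?] [_ ?]] := (hthhp k).1.
have C0K : C0 <= K by rewrite (le_trans (ler_norm C0)) // lerDr.
have dtt2 k : L2norm Omega ((tte k).2 - (tt k).2) <= K * eps.
  apply: le_trans (L2norm_curlB_le _ _ _) _; apply: le_trans (dtt k) _.
  by rewrite ler_wpM2r // ltW.
have dtthp2 k : L2norm Omega ((tthp k).2 - (tte k).2) <= (1 + k0) * E0.
  rewrite L2norm_subC; apply: le_trans (L2norm_curlB_le _ _ _) _.
  by apply: le_trans (dtthp k) _; rewrite ler_wpM2r ?lerDr // ltW.
have dthK k : Hcurl_normC Omega (the k - th k) <= K * (eps * nu).
  by apply: le_trans (dth k) _; rewrite -mulrA ler_wpM2r // mulr_ge0 // ltW.
have dthhpK k : Hcurl_normC Omega (the k - thhp k) <= (1 + k1) * E1.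
  by apply: le_trans (dthhp k) _; rewrite ler_wpM2r ?lerDr // ltW.
have en0 : 0 <= eps * nu by rewrite mulr_ge0 // ltW.
have [alpha_ge0 eps_ge0 nu_ge0] : [/\ 0 <= alpha, 0 <= eps & 0 <= nu].
  by split; exact: ltW.
have [E0_ge0 E1_ge0] := (ltW E00, ltW E10).
have k01 : 1 <= 1 + k0 by rewrite lerDl ltW.
have k11 : 1 <= 1 + k1 by rewrite lerDl ltW.
have k1_ge0 : 0 <= 1 + k1 := le_trans ler01 k11.
have K_ge0 : 0 <= K := ltW K0.
have MN : M <= M * (1 + nu) by rewrite ler_peMr ?(ltW M0) // lerDl ltW.
have nuMN : nu <= M * (1 + nu).
  by rewrite -[leLHS]mul1r ler_pM // ?(ltW nu0) // lerDr.
split.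
- apply: le_trans (ler_distD (N0 Omega B mur alpha tte i j) _ _) _.
  apply: lerD.
    apply: le_trans (N0_perturb mO mB hmur alpha0 i j K1 (ltW eps0) Ltt Ltte dtt2) _.
    rewrite -/M; set s := eps + _ + _.
    have s0 : 0 <= s by rewrite !addr_ge0 ?sqrtr_ge0 // ltW.
    have -> : alpha ^+ 3 * (M * (K ^+ 2 * (eps * s)))
      = M * K ^+ 2 * 1 * (eps * alpha ^+ 3 * s) by ring.
    have -> : M * K ^+ 2 * (1 + 2 * t) * eps * alpha ^+ 3 * s
      = M * K ^+ 2 * (1 + 2 * t) * (eps * alpha ^+ 3 * s) by ring.
    apply: ler_wpM2r; first by rewrite !mulr_ge0 // ltW.
    by rewrite ler_wpM2l // mulr_ge0 ?exprn_ge0 // ltW.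
  apply: le_trans (N0_perturb mO mB hmur alpha0 i j k01 (ltW E00) Ltte Ltthp dtthp2) _.
  by rewrite -/M !mulrA.
- apply: le_trans (ler_distD (Rcoef Omega B mur alpha the i j) _ _) _.
  rewrite rmorphD; apply: lerD.
    apply: le_trans (Rcoef_perturb mO mB hmur alpha0 i j K1 en0 _ _ _) _.
    + by move=> k; have [] := Lth k.
    + by move=> k; have [] := Lthe k.
    + by move=> k; exact: le_trans (L2normC_curlB_le _ _ _) (dthK k).
    rewrite lecR -/M; set s := eps * nu + _ + _.
    have s0 : 0 <= s by rewrite !addr_ge0 ?sqrtr_ge0.
    have -> : alpha ^+ 3 * (M * (K ^+ 2 * (eps * nu * s)))
      = M * K ^+ 2 * 1 * (eps * nu * alpha ^+ 3 * s) by ring.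
    have -> : M * K ^+ 2 * (1 + 2 * t) * eps * nu * alpha ^+ 3 * s
      = M * K ^+ 2 * (1 + 2 * t) * (eps * nu * alpha ^+ 3 * s) by ring.
    apply: ler_wpM2r; first by rewrite !mulr_ge0 // ltW.
    by rewrite ler_wpM2l // mulr_ge0 ?exprn_ge0 // ltW.
  apply: le_trans (Rcoef_perturb mO mB hmur alpha0 i j k11 (ltW E10) _ _ _) _.
  + by move=> k; have [] := Lthe k.
  + by move=> k; have [] := Lthhp k.
  + move=> k; rewrite L2normC_subC.
    exact: le_trans (L2normC_curlB_le _ _ _) (dthhpK k).
  rewrite lecR -/M; set s := E1 + _ + _.
  have s0 : 0 <= s by rewrite !addr_ge0 ?sqrtr_ge0 // ltW.
  have -> : alpha ^+ 3 * (M * ((1 + k1) ^+ 2 * (E1 * s)))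
    = alpha ^+ 3 * ((1 + k1) ^+ 2 * (E1 * s)) * (M * 1) by ring.
  have -> : alpha ^+ 3 * (M * (1 + nu)) * (1 + k1) ^+ 2 * (1 + 2 * t) * E1 * s
    = alpha ^+ 3 * ((1 + k1) ^+ 2 * (E1 * s)) * (M * (1 + nu) * (1 + 2 * t)).
    by ring.
  apply: ler_wpM2l; first by rewrite !mulr_ge0.
  exact: (ler_pM (ltW M0) ler01 MN T1).
(* The contribution 2 t of the source is absorbed into 1 + 2 t thanks to the
   summand 1 on the right. *)
have split_t (e x y : R) : 0 <= e -> 0 <= x -> 0 <= y ->
    e + (x + t + (y + t)) <= (1 + 2 * t) * (1 + e + x + y).
  move=> e0 x0 y0; rewrite -subr_ge0.
  have -> : (1 + 2 * t) * (1 + e + x + y) - (e + (x + t + (y + t)))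
    = 1 + 2 * (t * (e + x + y)) by ring.
  by rewrite !(addr_ge0, mulr_ge0).
apply: le_trans (ler_distD (Icoef B nu alpha (theta0 tt) the i j) _ _) _.
have LB k (u : 'I_3 -> hfieldC R) : L2C Omega (u k).1 -> L2C B (u k).1.
  exact: L2CS.
have dB (u v : hfieldC R) e : L2C Omega u.1 -> L2C Omega v.1 ->
    Hcurl_normC Omega (u - v) <= e -> L2normC B (u.1 - v.1) <= e.
  move=> Lu Lv; apply: le_trans; apply: le_trans (L2normCB_le _ _ _).
  exact: L2normCS (L2CB mO Lu Lv).
rewrite rmorphD; apply: lerD.
  apply: le_trans (Icoef_perturb mB alpha0 i j nu0 K1 en0 L0 ht _ _ _) _.
  + by move=> k; have [/LB] := Lth k.
  + by move=> k; have [/LB] := Lthe k.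
  + by move=> k; apply: dB (dthK k); [have [] := Lthe k|have [] := Lth k].
  rewrite lecR.
  have := split_t (eps * nu) (L2normC B (the i).1) (L2normC B (the j).1) en0
    (sqrtr_ge0 _) (sqrtr_ge0 _).
  set s := _ + (_ + _); set s' := 1 + _ + _ + _ => ss'.
  have s'0 : 0 <= (1 + 2 * t) * s'.
    by rewrite mulr_ge0 ?(ltW T0) // !addr_ge0 ?sqrtr_ge0.
  have -> : alpha ^+ 3 * (nu * (K ^+ 2 * (eps * nu * s)))
    = eps * nu ^+ 2 * alpha ^+ 3 * K ^+ 2 * (1 * s) by ring.
  have -> : M * K ^+ 2 * (1 + 2 * t) * eps * nu ^+ 2 * alpha ^+ 3 * s'
    = eps * nu ^+ 2 * alpha ^+ 3 * K ^+ 2 * (M * ((1 + 2 * t) * s')) by ring.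
  apply: ler_wpM2l; first by rewrite !mulr_ge0.
  by apply: le_trans (ler_wpM2r s'0 M1); rewrite !mul1r.
apply: le_trans (Icoef_perturb mB alpha0 i j nu0 k11 (ltW E10) L0 ht _ _ _) _.
+ by move=> k; have [/LB] := Lthe k.
+ by move=> k; have [/LB] := Lthhp k.
+ move=> k; rewrite L2normC_subC.
  by apply: dB (dthhpK k); [have [] := Lthe k|have [] := Lthhp k].
rewrite lecR.
have := split_t E1 (L2normC B (thhp i).1) (L2normC B (thhp j).1) (ltW E10)
  (sqrtr_ge0 _) (sqrtr_ge0 _).
set s := _ + (_ + _); set s' := 1 + _ + _ + _ => ss'.
have s'0 : 0 <= (1 + 2 * t) * s'.
  by rewrite mulr_ge0 ?(ltW T0) // !addr_ge0 ?sqrtr_ge0 // ltW.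
have -> : alpha ^+ 3 * (nu * ((1 + k1) ^+ 2 * (E1 * s)))
  = alpha ^+ 3 * ((1 + k1) ^+ 2 * E1) * (nu * s) by ring.
have -> : alpha ^+ 3 * (M * (1 + nu)) * (1 + k1) ^+ 2 * (1 + 2 * t) * E1 * s'
  = alpha ^+ 3 * ((1 + k1) ^+ 2 * E1) * (M * (1 + nu) * ((1 + 2 * t) * s')).
  by ring.
apply: ler_wpM2l; first by rewrite !mulr_ge0.
apply: le_trans (ler_wpM2l (ltW nu0) ss') _.
exact: ler_wpM2r.
Qed.
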